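(* Let $(\omega,\Omega)$ be a regular almost-cosymplectic-contact structure on $M$ with dual pair $(E,\Lambda)$. A vector field $X$ on $M$ is an infinitesimal symmetry of $E$, i.e. $L_XE=[X,E]=0$, if and only if $X=X_{(\alpha,h)}$ for a 1-form $\alpha$ and a function $h\in C^\infty(M)$ satisfying $$\big(L_E\alpha-\alpha(E)\,L_E\omega\big)^\sharp=0,\qquad E.h+\Lambda(L_E\omega,\alpha)=0.$$
   Context: $M$ is a smooth manifold of dimension $2n+1$; everything is smooth. A regular almost-cosymplectic-contact structure on $M$ is a pair $(\omega,\Omega)$ of a 1-form $\omega$ and a 2-form $\Omega$ with $d\Omega=0$ and $\omega\wedge\Omega^n$ nowhere zero. Write $\Omega^\flat:TM\to T^*M$, $Y\mapsto Y^\flat=i_Y\Omega$, and for a bivector field $\Lambda$ write $\Lambda^\sharp:T^*M\to TM$, $\alpha\mapsto\alpha^\sharp=i_\alpha\Lambda$, i.e. $\beta(\alpha^\sharp)=\Lambda(\alpha,\beta)$. The dual pair $(E,\Lambda)$ is the unique pair of a vector field $E$ (the Reeb vector field) and a bivector field $\Lambda$ such that $(\Omega^\flat|_{\mathrm{Im}\,\Lambda^\sharp})^{-1}=\Lambda^\sharp|_{\mathrm{Im}\,\Omega^\flat}$, $i_E\omega=1$, $i_E\Omega=0$, $i_\omega\Lambda=0$. For a 1-form $\alpha$ and a function $h$ put $X_{(\alpha,h)}=\alpha^\sharp+hE$. Every vector field is of this form, with $h=\omega(X)$ and $\alpha$ determined up to adding a function multiple of $\omega$. $L$ denotes the Lie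 derivative and $Y.h$ the derivative of a function $h$ along a vector field $Y$. *)

(* Defs.v *)
From HB Require Import structures.
From mathcomp Require Import all_boot all_order all_algebra all_fingroup.
From mathcomp Require Import all_classical all_reals all_analysis.

Set Implicit Arguments.
Unset Strict Implicit.
Unset Printing Implicit Defensive.

Import Order.TTheory GRing.Theory Num.Theory.
Import numFieldNormedType.Exports.

Local Open Scope classical_set_scope.
Local Open Scope ring_scope.

(* Conventions.  R^d is 'rV[R]_d.  Both tangent vectors and covectors are row
   vectors; 2-forms and bivectors are skew-symmetric d x d matrices, with
   Omega(u, v) = u *m Omega *m v^T and Lambda(a, b) = a *m Lambda *m b^T.
   A tensor field on a manifold is the family of its local representatives
   in the charts of the atlas, subject to the transformation law; only the
   values of a representative on the image of its chart are meaningful. *)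

Section EuclideanSmoothness.
Context {R : realType} {d : nat}.
Implicit Types (U : set 'rV[R]_d) (f : 'rV[R]_d -> R).

Definition partial (a : 'I_d) f : 'rV[R]_d -> R :=
  fun x => 'D_(delta_mx 0 a) f x.

(* f is of class C^k on the open set U *)
Fixpoint Ck_on (k : nat) U f : Prop :=
  (forall x, U x -> {for x, continuous f}) /\
  match k with
  | 0%N => True
  | k'.+1 => forall a : 'I_d,
      (forall x, U x -> derivable f x (delta_mx 0 a)) /\
      Ck_on k' U (partial a f)
  end.

Definition smooth_on U f : Prop := forall k, Ck_on k U f.

End EuclideanSmoothness.

(* A smooth d-manifold, given by an atlas.  [chart i] and [chart_inv i] are
   only meaningful on [chart_dom i] and on its image, respectively. *)
Record smooth_manifold (R : realType) (d : nat) := SmoothManifold {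
  carrier :> topologicalType;
  manifold_hausdorff : hausdorff_space carrier;
  manifold_second_countable : @second_countable carrier;
  chart_index : Type;
  chart_dom : chart_index -> set carrier;
  chart : chart_index -> carrier -> 'rV[R]_d;
  chart_inv : chart_index -> 'rV[R]_d -> carrier;
  chart_cover : forall p : carrier, exists i, chart_dom i p;
  chart_dom_open : forall i, open (chart_dom i);
  chart_im_open : forall i, open (chart i @` chart_dom i);
  chartK : forall i p, chart_dom i p -> chart_inv i (chart i p) = p;
  chart_continuous : forall i p, chart_dom i p ->
    {for p, continuous (chart i)};
  chart_inv_continuous : forall i x, (chart i @` chart_dom i) x ->
    {for x, continuous (chart_inv i)};
  transition_smooth : forall i j (a : 'I_d),
    smooth_on (chart i @` (chart_dom i `&` chart_dom j))
              (fun x => chart j (chart_inv i x) 0 a) }.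

Arguments chart_index {R d} s.
Arguments chart_dom {R d s} i.
Arguments chart {R d s} i.
Arguments chart_inv {R d s} i.

Section Fields.
Context {R : realType} {d : nat}.
Variable M : smooth_manifold R d.
Implicit Types (i j : chart_index M) (x : 'rV[R]_d).

Definition chart_im i : set 'rV[R]_d := chart i @` chart_dom i.

Definition overlap i j : set 'rV[R]_d :=
  chart i @` (chart_dom i `&` chart_dom j).

Definition transition i j : 'rV[R]_d -> 'rV[R]_d := chart j \o chart_inv i.

Definition local_fun (h : M -> R) i : 'rV[R]_d -> R := h \o chart_inv i.

Record smooth_function := SmoothFunction {
  fun_val :> M -> R;
  fun_smooth : forall i, smooth_on (chart_im i) (local_fun fun_val i) }.

(* The library's Jacobian acts on rows: it is the matrix whose (a, b) entry
   is the a-th partial derivative of the b-th component. *)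
Record vector_field := VectorField {
  vf_rep :> chart_index M -> 'rV[R]_d -> 'rV[R]_d;
  vf_smooth : forall i (a : 'I_d),
    smooth_on (chart_im i) (fun x => vf_rep i x 0 a);
  vf_transform : forall i j x, overlap i j x ->
    vf_rep j (transition i j x) = vf_rep i x *m 'J (transition i j) x }.

Record one_form := OneForm {
  form1_rep :> chart_index M -> 'rV[R]_d -> 'rV[R]_d;
  form1_smooth : forall i (a : 'I_d),
    smooth_on (chart_im i) (fun x => form1_rep i x 0 a);
  form1_transform : forall i j x, overlap i j x ->
    form1_rep i x
    = form1_rep j (transition i j x) *m ('J (transition i j) x)^T }.

Record two_form := TwoForm {
  form2_rep :> chart_index M -> 'rV[R]_d -> 'M[R]_d;
  form2_skew : forall i x, chart_im i x ->
    (form2_rep i x)^T = - form2_rep i x;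
  form2_smooth : forall i (a b : 'I_d),
    smooth_on (chart_im i) (fun x => form2_rep i x a b);
  form2_transform : forall i j x, overlap i j x ->
    form2_rep i x = 'J (transition i j) x
      *m form2_rep j (transition i j x) *m ('J (transition i j) x)^T }.

Record bivector_field := BivectorField {
  bv_rep :> chart_index M -> 'rV[R]_d -> 'M[R]_d;
  bv_skew : forall i x, chart_im i x -> (bv_rep i x)^T = - bv_rep i x;
  bv_smooth : forall i (a b : 'I_d),
    smooth_on (chart_im i) (fun x => bv_rep i x a b);
  bv_transform : forall i j x, overlap i j x ->
    bv_rep j (transition i j x) = ('J (transition i j) x)^T
      *m bv_rep i x *m 'J (transition i j) x }.

End Fields.

Arguments chart_im {R d M} i.
Arguments overlap {R d M} i j.
Arguments transition {R d M} i j.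
Arguments local_fun {R d M} h i.

Section PointwiseAlgebra.
Context {R : realType} {d : nat}.
Implicit Types (v a b w : 'rV[R]_d) (W L : 'M[R]_d).

Definition pairing a v : R := (v *m a^T) 0 0.

(* i_v Omega = Omega(v, _) *)
Definition flat W v : 'rV[R]_d := v *m W.

(* i_a Lambda, i.e. b(a^sharp) = Lambda(a, b) *)
Definition sharp L a : 'rV[R]_d := a *m L.

Definition bv_eval L a b : R := (a *m L *m b^T) 0 0.

Definition multiform (k : nat) := ('I_k -> 'rV[R]_d) -> R.

Definition multiform1 w : multiform 1 := fun vs => pairing w (vs ord0).

Definition multiform2 W : multiform 2 :=
  fun vs => (vs ord0 *m W *m (vs ord_max)^T) 0 0.

Definition wedge (k l : nat) (p : multiform k) (q : multiform l) :
    multiform (k + l) := fun vs =>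
  ((k`! * l`!)%N%:R)^-1 * \sum_(s : 'S_(k + l))
    (-1) ^+ s * (p (fun t => vs (s (lshift l t)))
                 * q (fun t => vs (s (rshift k t)))).

Fixpoint wedge_power W (n : nat) : multiform n.*2 :=
  match n return multiform n.*2 with
  | 0%N => fun=> 1
  | n'.+1 => wedge (multiform2 W) (@wedge_power W n')
  end.

End PointwiseAlgebra.

Arguments wedge_power {R d} W n _.

(* The differential operators below are given by their coordinate expressions
   in each chart. *)
Section Calculus.
Context {R : realType} {d : nat} {M : smooth_manifold R d}.
Implicit Types (X Y E : vector_field M) (al : one_form M).

Definition lie_bracket X Y (i : chart_index M) (x : 'rV[R]_d) : 'rV[R]_d :=
  \row_a \sum_b (X i x 0 b * partial b (fun y => Y i y 0 a) x
                 - Y i x 0 b * partial b (fun y => X i y 0 a) x).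

Definition lie_form1 E al (i : chart_index M) (x : 'rV[R]_d) : 'rV[R]_d :=
  \row_a \sum_b (E i x 0 b * partial b (fun y => al i y 0 a) x
                 + al i x 0 b * partial a (fun y => E i y 0 b) x).

Definition fun_deriv E (h : smooth_function M) (i : chart_index M)
    (x : 'rV[R]_d) : R :=
  \sum_b E i x 0 b * partial b (local_fun h i) x.

(* component (a, b, c) of the exterior derivative of a 2-form *)
Definition ext_deriv2 (W : two_form M) (i : chart_index M) (x : 'rV[R]_d)
    (a b c : 'I_d) : R :=
  partial a (fun y => W i y b c) x + partial b (fun y => W i y c a) x
  + partial c (fun y => W i y a b) x.

(* L_X E = [X, E] = 0 *)
Definition infinitesimal_symmetry X E : Prop :=
  forall i x, chart_im i x -> lie_bracket X E i x = 0.

(* X = al^sharp + h E *)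
Definition is_sharp_Reeb_combination (E : vector_field M)
    (L : bivector_field M) X al (h : smooth_function M) : Prop :=
  forall i x, chart_im i x ->
    X i x = sharp (L i x) (al i x) + local_fun h i x *: E i x.

End Calculus.

(* omega /\ Omega^n is nowhere zero and d Omega = 0 *)
Definition regular_almost_cosymplectic_contact (R : realType) (n : nat)
    (M : smooth_manifold R n.*2.+1) (om : one_form M) (Om : two_form M) :
    Prop :=
  (forall i x, chart_im i x -> forall a b c, ext_deriv2 Om i x a b c = 0) /\
  (forall i x, chart_im i x -> exists v : 'I_(1 + n.*2) -> 'rV[R]_n.*2.+1,
     wedge (multiform1 (om i x)) (wedge_power (Om i x) n) v != 0).

(* The first two clauses say that flat : Im sharp -> Im flat and
   sharp : Im flat -> Im sharp are mutually inverse. *)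
Definition dual_pair (R : realType) (d : nat) (M : smooth_manifold R d)
    (om : one_form M) (Om : two_form M)
    (E : vector_field M) (L : bivector_field M) : Prop :=
  forall i x, chart_im i x ->
  [/\ forall v, range (sharp (L i x)) v ->
        sharp (L i x) (flat (Om i x) v) = v,
      forall a, range (flat (Om i x)) a ->
        flat (Om i x) (sharp (L i x) a) = a,
      pairing (om i x) (E i x) = 1,
      flat (Om i x) (E i x) = 0 &
      sharp (L i x) (om i x) = 0].

(* Main.v *)
Require Import Defs.
From HB Require Import structures.
From mathcomp Require Import all_boot all_order all_algebra all_fingroup.
From mathcomp Require Import all_classical all_reals all_analysis.
From mathcomp Require Import ring lra.

Set Implicit Arguments.
Unset Strict Implicit.
Unset Printing Implicit Defensive.

Import Order.TTheory GRing.Theory Num.Theory.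
Import numFieldNormedType.Exports.

Local Open Scope ring_scope.

(** In a chart write [W], [L] for the matrices of Omega and Lambda, [w] for
    omega, [J] for the matrix of partial derivatives of the Reeb field [E].

    Regularity says exactly that ker Omega is the line of [E]: a vector [v]
    killed by both omega and Omega kills every slot of the top form
    omega /\ Omega^n, and a multilinear alternating top form killed by a
    nonzero vector vanishes ([top_form_eq0], [regular_kernel_eq0]).  Together
    with the duality relations this yields the splitting of the tangent space
    [W *m L + w^T *m E = 1] ([dual_pair_splitting]), i.e. every field is
    [X = al^sharp + h E] with [al = i_X Omega] and [h = omega(X)].

    Since [d Omega = 0] and [i_E Omega = 0], Cartan's formula gives
    [L_E Omega = 0] ([reeb_lie_form2_eq0]).  Applying [L_E] to the splitting and
    to [i_omega Lambda = 0] then determines [L_E Lambda] in terms of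
    [lam = L_E omega] ([reeb_lie_bivector]), and the Leibniz rule gives

      [E, X] = (L_E al - al(E) lam)^sharp + (E.h + Lambda(lam, al)) E

    for every presentation [X = al^sharp + h E] ([reeb_bracket]).  The two
    summands lie in the complementary subspaces Im Lambda^sharp and the line of
    [E], so the bracket vanishes iff both coefficients do.  The equivalence
    thus holds for every presentation of [X]; existence of one with globally
    smooth [al] and [h] is the only further point ([flat_form],
    [pairing_fun]). *)

(** * Multilinear alternating forms *)

Section AlternatingForms.
Context {R : realType} {d : nat}.
Implicit Types (k l : nat) (u v w : 'rV[R]_d) (W : 'M[R]_d).

Definition set_slot k (vs : 'I_k -> 'rV[R]_d) (i : 'I_k) u : 'I_k -> 'rV[R]_d :=
  fun t => if t == i then u else vs t.

Definition multilinear_form k (p : @multiform R d k) :=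
  forall vs i a u w, p (set_slot vs i (a *: u + w))
    = a * p (set_slot vs i u) + p (set_slot vs i w).

Definition alternating k (p : @multiform R d k) :=
  forall vs i j, i != j -> vs i = vs j -> p vs = 0.

Definition annihilated_by v k (p : @multiform R d k) :=
  forall vs i, vs i = v -> p vs = 0.

Lemma set_slot_id k (vs : 'I_k -> 'rV[R]_d) i : set_slot vs i (vs i) = vs.
Proof. by apply: funext => t; rewrite /set_slot; case: eqP => // ->. Qed.

Lemma set_slotE k (vs : 'I_k -> 'rV[R]_d) i u : set_slot vs i u i = u.
Proof. by rewrite /set_slot eqxx. Qed.

Lemma set_slot_comp k l (f : 'I_l -> 'I_k) vs t u : injective f ->
  (fun s => set_slot vs (f t) u (f s)) = set_slot (fun s => vs (f s)) t u.
Proof.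
by move=> finj; apply: funext => s; rewrite /set_slot (inj_eq finj).
Qed.

Lemma set_slot_comp_out k l (f : 'I_l -> 'I_k) vs i u :
  (forall s, f s != i) ->
  (fun s => set_slot vs i u (f s)) = (fun s => vs (f s)).
Proof.
by move=> fi; apply: funext => s; rewrite /set_slot (negbTE (fi s)).
Qed.

Lemma multilinear_slot_sum k (p : @multiform R d k) :
  multilinear_form p ->
  forall vs i (I : finType) (c : I -> R) (u : I -> 'rV[R]_d),
  p (set_slot vs i (\sum_t c t *: u t))
  = \sum_t c t * p (set_slot vs i (u t)).
Proof.
move=> plin vs i I c u; elim/big_rec2: _ => [|t y1 y2 _ <-]; last exact: plin.
(* the form vanishes at a zero slot: expand [0 = -1 *: 0 + 0] *)
by have := plin vs i (-1) 0 0; rewrite scaler0 addr0 mulN1r addNr.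
Qed.

(** In the term of a wedge product indexed by [s], slot [i] is an argument of
    exactly one of the two factors; the two cases tell which one. *)
Lemma shuffled_slot k l (s : 'S_(k + l)) (i : 'I_(k + l)) :
  (exists t, s (lshift l t) = i) \/ (exists t, s (rshift k t) = i).
Proof.
rewrite -(permKV s i); case: (splitP (s^-1%g i)) => t et; [left | right].
  by exists t; congr (s _); apply: val_inj.
by exists t; congr (s _); apply: val_inj.
Qed.

Let lshift_perm_inj k l (s : 'S_(k + l)) :
  injective (fun t => s (lshift l t)).
Proof. by move=> t t' /perm_inj /lshift_inj. Qed.

Let rshift_perm_inj k l (s : 'S_(k + l)) :
  injective (fun t => s (rshift k t)).
Proof. by move=> t t' /perm_inj /rshift_inj. Qed.

Lemma wedge_multilinear k l (p : @multiform R d k) (q : @multiform R d l) :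
  multilinear_form p -> multilinear_form q -> multilinear_form (wedge p q).
Proof.
move=> plin qlin vs i a u w; rewrite /wedge; set c := _^-1.
rewrite [a * _]mulrCA -[RHS]mulrDr; congr (_ * _).
rewrite mulr_sumr -big_split /=; apply: eq_bigr => s _.
rewrite [a * _]mulrCA -[RHS]mulrDr; congr (_ * _).
have [[t <-]|[t <-]] := shuffled_slot s i.
- have out z : (fun t0 => set_slot vs (s (lshift l t)) z (s (rshift k t0)))
      = (fun t0 => vs (s (rshift k t0))).
    by apply: set_slot_comp_out => t0; rewrite (inj_eq perm_inj) eq_rlshift.
  have /= inn := fun z => set_slot_comp vs t z (@lshift_perm_inj k l s).
  by rewrite !out !inn plin mulrDl mulrA.
- have out z : (fun t0 => set_slot vs (s (rshift k t)) z (s (lshift l t0)))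
      = (fun t0 => vs (s (lshift l t0))).
    by apply: set_slot_comp_out => t0; rewrite (inj_eq perm_inj) eq_lrshift.
  have /= inn := fun z => set_slot_comp vs t z (@rshift_perm_inj k l s).
  by rewrite !out !inn qlin mulrDr mulrCA.
Qed.

Lemma wedge_annihilated v k l (p : @multiform R d k) (q : @multiform R d l) :
  annihilated_by v p -> annihilated_by v q -> annihilated_by v (wedge p q).
Proof.
move=> pv qv vs i vsi; rewrite /wedge big1 ?mulr0 // => s _.
have [[t st]|[t st]] := shuffled_slot s i.
- by rewrite (pv _ t) ?mul0r ?mulr0 // st.
- by rewrite (qv _ t) ?mulr0 // st.
Qed.

(** Composing the permutations with the transposition of the two equal slots
    changes the sign of the sum but not its value. *)
Lemma wedge_alternating k l (p : @multiform R d k) (q : @multiform R d l) :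
  alternating (wedge p q).
Proof.
move=> vs i j ij vsij; rewrite /wedge.
set S := (X in _ * X); suff : S = - S.
  by move/esym/eqP; rewrite eqNr => /eqP ->; rewrite mulr0.
rewrite {1}/S (reindex_inj (mulIg (tperm i j))) /= -sumrN.
apply: eq_bigr => s _.
have vst t : vs ((s * tperm i j)%g t) = vs (s t).
  by rewrite permM; case: tpermP => // ->.
under [in p _]eq_fun do rewrite vst.
under [in q _]eq_fun do rewrite vst.
by rewrite odd_permM odd_tperm ij addbT signrN mulNr.
Qed.

Lemma multiform1_multilinear w : multilinear_form (multiform1 w).
Proof.
move=> vs i a u z; rewrite /multiform1 (ord1 i) !set_slotE /pairing.
by rewrite mulmxDl -scalemxAl !mxE.
Qed.

Lemma multiform2_multilinear W : multilinear_form (multiform2 W).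
Proof.
move=> vs i a u z; rewrite /multiform2 /set_slot.
have [->|->] : i = ord0 \/ i = ord_max.
- by case: i => [[|[|//]] ?]; [left | right]; apply: val_inj.
- by rewrite /= !mulmxDl -!scalemxAl [LHS]mxE [X in X + _]mxE.
- rewrite /= linearD linearZ /= mulmxDr -scalemxAr.
  by rewrite [LHS]mxE [X in X + _]mxE.
Qed.

Lemma wedge_power_multilinear W n : multilinear_form (wedge_power W n).
Proof.
elim: n => [|n IHn]; first by move=> vs [].
exact: wedge_multilinear (@multiform2_multilinear W) IHn.
Qed.

(** Skew symmetry turns [v *m W = 0] into [W *m v^T = 0], which handles the
    second slot of the 2-form. *)
Lemma wedge_power_annihilated v W n :
  W^T = - W -> v *m W = 0 -> annihilated_by v (wedge_power W n).
Proof.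
move=> Wskew vW; elim: n => [|n IHn]; first by move=> vs [].
apply: (@wedge_annihilated v 2 _ (multiform2 W)) IHn => vs i.
rewrite /multiform2.
have [->|->] : i = ord0 \/ i = ord_max.
- by case: i => [[|[|//]] ?]; [left | right]; apply: val_inj.
- by move=> ->; rewrite vW mul0mx mxE.
- move=> ->; rewrite -mulmxA -[W]trmxK -trmx_mul Wskew mulmxN vW oppr0.
  by rewrite trmx0 mulmx0 mxE.
Qed.

(** By multilinearity it is enough to evaluate the form on basis vectors.  If
    one of them is repeated the value is zero; otherwise some slot holds a
    basis vector that occurs in [v], and replacing it by [v] changes the value
    by a nonzero factor only, since the other terms of [v] repeat a vector. *)
Lemma top_form_eq0 (F : @multiform R d d) v : v != 0 ->
  multilinear_form F -> alternating F -> annihilated_by v F ->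
  forall vs, F vs = 0.
Proof.
move=> v0 Flin Falt Fv vs.
(* [m] bounds the slots that may still hold an arbitrary vector *)
suff H m : (m <= d)%N -> forall us : 'I_d -> 'rV[R]_d,
    (forall i : 'I_d, (m <= i)%N -> exists k : 'I_d, us i = delta_mx 0 k) ->
    F us = 0.
  by apply: (H d) => // i; rewrite leqNgt ltn_ord.
elim: m => [_|m IHm md] us usb; last first.
  pose i := Ordinal md; rewrite -(set_slot_id us i) (row_sum_delta (us i)).
  rewrite multilinear_slot_sum // big1 // => k _.
  rewrite IHm ?mulr0 ?(ltnW md) // => j mj; rewrite /set_slot.
  case: eqP => [_|/eqP ji]; first by exists k.
  by apply: usb; rewrite ltn_neqAle mj andbT eq_sym.
have /fin_all_exists[f fE] :
    forall i : 'I_d, exists k : 'I_d, us i = delta_mx 0 k.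
  by move=> i; exact: usb.
have [/injectiveP finj|/injectivePn[i [j ij fij]]] := boolP (injectiveb f);
  last by apply: (Falt _ i j) => //; rewrite !fE fij.
have [g fK gK] := injF_bij finj.
have /rV0Pn[k0 vk0] := v0.
have := Fv (set_slot us (g k0) v) (g k0) (set_slotE _ _ _).
rewrite (row_sum_delta v) multilinear_slot_sum // (bigD1 k0) //=.
rewrite big1 => [|k kk0].
  have -> : delta_mx 0 k0 = us (g k0) by rewrite fE gK.
  rewrite set_slot_id addr0 => /eqP.
  by rewrite mulf_eq0 (negbTE vk0) => /eqP.
rewrite (Falt _ (g k0) (g k)) ?mulr0 //.
  by rewrite (inj_eq (can_inj gK)) eq_sym.
by rewrite set_slotE /set_slot (inj_eq (can_inj gK)) (negbTE kk0) fE gK.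
Qed.

End AlternatingForms.

(** * Smooth functions on open subsets of a coordinate space *)

Section SmoothFunctions.
Context {R : realType} {d : nat}.
Implicit Types (U : set 'rV[R]_d) (f g : 'rV[R]_d -> R).

Lemma near_open_eq (T : Type) U (f g : 'rV[R]_d -> T) x :
  open U -> U x -> (forall y, U y -> f y = g y) -> \near x, f x = g x.
Proof.
move=> Uo Ux fg; near=> y; apply: fg; near: y.
exact: open_nbhs_nbhs.
Unshelve. all: by end_near. Qed.

Lemma partial_local U f g a x : open U -> U x ->
  (forall y, U y -> f y = g y) -> partial a f x = partial a g x.
Proof. by move=> Uo Ux fg; apply: near_eq_derive; exact: near_open_eq fg. Qed.

Lemma derivable_local U f g x v : open U -> U x ->
  (forall y, U y -> f y = g y) -> derivable f x v -> derivable g x v.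
Proof.
by move=> Uo Ux fg; apply: near_eq_derivable; exact: near_open_eq fg.
Qed.

Lemma continuous_local U f g x : open U -> U x ->
  (forall y, U y -> f y = g y) ->
  {for x, continuous f} -> {for x, continuous g}.
Proof.
move=> Uo Ux fg fc; rewrite /prop_for /continuous_at -(fg x Ux).
exact: cvg_trans (near_eq_cvg (near_open_eq Uo Ux fg)) fc.
Qed.

(** Tensor identities hold on the image of a chart only, so smoothness has to be
    transported along equalities on an open set, where all iterated partial
    derivatives agree. *)
Lemma Ck_on_local k U f g : open U -> (forall y, U y -> f y = g y) ->
  Ck_on k U f -> Ck_on k U g.
Proof.
move=> Uo; elim: k f g => [|k IHk] f g fg [fc fd].
  by split => // x Ux; exact: continuous_local Uo Ux fg (fc x Ux).
split => [x Ux|a]; first exact: continuous_local Uo Ux fg (fc x Ux).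
have [fda fpa] := fd a; split => [x Ux|].
  exact: derivable_local Uo Ux fg (fda x Ux).
by apply: IHk fpa => y Uy; exact: partial_local Uo Uy fg.
Qed.

Lemma Ck_on_pred k U f : Ck_on k.+1 U f -> Ck_on k U f.
Proof.
elim: k f => [|k IHk] f [fc fd]; split => // a.
by have [fda fpa] := fd a; split => //; exact: IHk.
Qed.

Lemma Ck_on_cst k U (c : R) : Ck_on k U (fun=> c).
Proof.
elim: k c => [|k IHk] c; first by split => // x _; exact: cst_continuous.
split => [x _|a]; first exact: cst_continuous.
split => [x _|]; first exact: derivable_cst.
rewrite (_ : partial a _ = fun=> 0) //; apply: funext => x.
exact: derive_cst.
Qed.

Lemma partialD f g a x : derivable f x (delta_mx 0 a) ->
  derivable g x (delta_mx 0 a) ->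
  partial a (fun y => f y + g y) x = partial a f x + partial a g x.
Proof. exact: deriveD. Qed.

Lemma partialM f g a x : derivable f x (delta_mx 0 a) ->
  derivable g x (delta_mx 0 a) ->
  partial a (fun y => f y * g y) x = partial a f x * g x + f x * partial a g x.
Proof.
by move=> df dg; rewrite addrC [_ * g x]mulrC; exact: deriveM.
Qed.

Lemma Ck_onD k U f g : open U ->
  Ck_on k U f -> Ck_on k U g -> Ck_on k U (fun y => f y + g y).
Proof.
move=> Uo; elim: k f g => [|k IHk] f g [fc fd] [gc gd].
  by split => // x Ux; apply: (@continuousD _ _ _ f g); [exact: fc | exact: gc].
split => [x Ux|a].
  by apply: (@continuousD _ _ _ f g); [exact: fc | exact: gc].
have [fda fpa] := fd a; have [gda gpa] := gd a; split => [x Ux|].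
  by apply: (@derivableD _ _ _ f g); [exact: fda | exact: gda].
apply: Ck_on_local Uo _ (IHk _ _ fpa gpa) => x Ux.
by rewrite partialD //; [exact: fda | exact: gda].
Qed.

(** In the Leibniz rule each factor occurs underived once, which is why the
    induction lowers its order with [Ck_on_pred]. *)
Lemma Ck_onM k U f g : open U ->
  Ck_on k U f -> Ck_on k U g -> Ck_on k U (fun y => f y * g y).
Proof.
move=> Uo; elim: k f g => [|k IHk] f g.
  move=> [fc _] [gc _]; split => // x Ux.
  by apply: (@continuousM _ _ f g); [exact: fc | exact: gc].
move=> fk gk; have [fc fd] := fk; have [gc gd] := gk; split => [x Ux|a].
  by apply: (@continuousM _ _ f g); [exact: fc | exact: gc].
have [fda fpa] := fd a; have [gda gpa] := gd a; split => [x Ux|].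
  by apply: (@derivableM _ _ f g); [exact: fda | exact: gda].
have fgk := IHk _ _ fpa (Ck_on_pred gk).
have gfk := IHk _ _ (Ck_on_pred fk) gpa.
apply: Ck_on_local Uo _ (Ck_onD Uo fgk gfk) => x Ux.
by rewrite partialM //; [exact: fda | exact: gda].
Qed.

Lemma smooth_on_local U f g : open U -> (forall y, U y -> f y = g y) ->
  smooth_on U f -> smooth_on U g.
Proof. by move=> Uo fg fs k; exact: Ck_on_local (fs k). Qed.

Lemma smooth_onM U f g : open U ->
  smooth_on U f -> smooth_on U g -> smooth_on U (fun y => f y * g y).
Proof. by move=> Uo fs gs k; exact: Ck_onM. Qed.

Lemma smooth_on_sum U (I : finType) (F : I -> 'rV[R]_d -> R) : open U ->
  (forall t, smooth_on U (F t)) -> smooth_on U (fun y => \sum_t F t y).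
Proof.
move=> Uo Fs k; rewrite /index_enum; elim: (Finite.enum I) => [|t s IHs].
  by under eq_fun do rewrite big_nil; exact: Ck_on_cst.
by under eq_fun do rewrite big_cons; apply: Ck_onD => //; exact: Fs.
Qed.

Lemma smooth_on_derivable U f a x :
  smooth_on U f -> U x -> derivable f x (delta_mx 0 a).
Proof. by move=> /(_ 1%N)[_ /(_ a)[fd _]]; exact: fd. Qed.

End SmoothFunctions.

(** * Entrywise derivatives of matrix-valued functions *)

Section MatrixDerivative.
Context {R : realType} {d : nat}.
Implicit Types (U : set 'rV[R]_d) (x v : 'rV[R]_d).

Definition smooth_mx U m p (F : 'rV[R]_d -> 'M[R]_(m, p)) :=
  forall a b, smooth_on U (fun y => F y a b).

Definition partial_mx c m p (F : 'rV[R]_d -> 'M[R]_(m, p)) x : 'M[R]_(m, p) :=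
  \matrix_(a, b) partial c (fun y => F y a b) x.

Definition deriv_mx v m p (F : 'rV[R]_d -> 'M[R]_(m, p)) x : 'M[R]_(m, p) :=
  \sum_c v 0 c *: partial_mx c F x.

Lemma deriv_mxE v m p (F : 'rV[R]_d -> 'M[R]_(m, p)) x a b :
  deriv_mx v F x a b = \sum_c v 0 c * partial c (fun y => F y a b) x.
Proof. by rewrite summxE; apply: eq_bigr => c _; rewrite !mxE. Qed.

Lemma smooth_mx_mul U m p q (F : 'rV[R]_d -> 'M[R]_(m, p))
    (G : 'rV[R]_d -> 'M[R]_(p, q)) : open U ->
  smooth_mx U F -> smooth_mx U G -> smooth_mx U (fun y => F y *m G y).
Proof.
move=> Uo Fs Gs a b; under eq_fun do rewrite mxE.
by apply: smooth_on_sum => // t; exact: smooth_onM.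
Qed.

Lemma smooth_mx_tr U m p (F : 'rV[R]_d -> 'M[R]_(m, p)) :
  smooth_mx U F -> smooth_mx U (fun y => (F y)^T).
Proof. by move=> Fs a b; under eq_fun do rewrite mxE; exact: Fs. Qed.

Lemma partial_sum (I : finType) (F : I -> 'rV[R]_d -> R) a x :
  (forall t, derivable (F t) x (delta_mx 0 a)) ->
  partial a (fun y => \sum_t F t y) x = \sum_t partial a (F t) x.
Proof.
move=> Fd; rewrite /index_enum; elim: (Finite.enum I) => [|t s IHs].
  rewrite big_nil; under [X in partial _ X]eq_fun do rewrite big_nil.
  exact: derive_cst.
rewrite big_cons -IHs; under [X in partial _ X]eq_fun do rewrite big_cons.
apply: partialD => //; elim: {IHs} s => [|s0 s IHs].
  by under eq_fun do rewrite big_nil; exact: derivable_cst.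
by under eq_fun do rewrite big_cons; exact: derivableD.
Qed.

Section AtPoint.
Context (U : set 'rV[R]_d) (x : 'rV[R]_d) (Uo : open U) (Ux : U x).

Lemma partial_mx_local c m p (F G : 'rV[R]_d -> 'M[R]_(m, p)) :
  (forall y, U y -> F y = G y) -> partial_mx c F x = partial_mx c G x.
Proof.
move=> FG; apply/matrixP => a b; rewrite !mxE.
by apply: partial_local Uo Ux _ => y Uy; rewrite FG.
Qed.

Lemma partial_mxM c m p q (F : 'rV[R]_d -> 'M[R]_(m, p))
    (G : 'rV[R]_d -> 'M[R]_(p, q)) :
  smooth_mx U F -> smooth_mx U G ->
  partial_mx c (fun y => F y *m G y) x
  = partial_mx c F x *m G x + F x *m partial_mx c G x.
Proof.
move=> Fs Gs; apply/matrixP => a b; rewrite !mxE.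
under [X in partial _ X]eq_fun do rewrite mxE.
have Fd t : derivable (fun y => F y a t) x (delta_mx 0 c).
  exact: smooth_on_derivable (Fs a t) Ux.
have Gd t : derivable (fun y => G y t b) x (delta_mx 0 c).
  exact: smooth_on_derivable (Gs t b) Ux.
rewrite partial_sum => [|t]; last exact: derivableM.
by rewrite -big_split /=; apply: eq_bigr => t _; rewrite partialM // !mxE.
Qed.

Lemma partial_mxD c m p (F G : 'rV[R]_d -> 'M[R]_(m, p)) :
  smooth_mx U F -> smooth_mx U G ->
  partial_mx c (fun y => F y + G y) x = partial_mx c F x + partial_mx c G x.
Proof.
move=> Fs Gs; apply/matrixP => a b; rewrite !mxE.
under [X in partial _ X]eq_fun do rewrite mxE.
by apply: partialD; [exact: smooth_on_derivable (Fs a b) Ux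
                    |exact: smooth_on_derivable (Gs a b) Ux].
Qed.

Lemma partial_mx_cst c m p (A : 'M[R]_(m, p)) : partial_mx c (fun=> A) x = 0.
Proof. by apply/matrixP => a b; rewrite !mxE; exact: derive_cst. Qed.

Lemma deriv_mx_local v m p (F G : 'rV[R]_d -> 'M[R]_(m, p)) :
  (forall y, U y -> F y = G y) -> deriv_mx v F x = deriv_mx v G x.
Proof.
by move=> FG; apply: eq_bigr => c _; rewrite (partial_mx_local c FG).
Qed.

Lemma deriv_mxM v m p q (F : 'rV[R]_d -> 'M[R]_(m, p))
    (G : 'rV[R]_d -> 'M[R]_(p, q)) :
  smooth_mx U F -> smooth_mx U G ->
  deriv_mx v (fun y => F y *m G y) x
  = deriv_mx v F x *m G x + F x *m deriv_mx v G x.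
Proof.
move=> Fs Gs; rewrite mulmx_suml mulmx_sumr -big_split; apply: eq_bigr => c _.
by rewrite partial_mxM // scalerDr scalemxAl scalemxAr.
Qed.

Lemma deriv_mxD v m p (F G : 'rV[R]_d -> 'M[R]_(m, p)) :
  smooth_mx U F -> smooth_mx U G ->
  deriv_mx v (fun y => F y + G y) x = deriv_mx v F x + deriv_mx v G x.
Proof.
move=> Fs Gs; rewrite -big_split; apply: eq_bigr => c _.
by rewrite partial_mxD // scalerDr.
Qed.

Lemma deriv_mx_cst v m p (A : 'M[R]_(m, p)) : deriv_mx v (fun=> A) x = 0.
Proof. by rewrite /deriv_mx big1 // => c _; rewrite partial_mx_cst scaler0. Qed.

Lemma deriv_mx_tr v m p (F : 'rV[R]_d -> 'M[R]_(m, p)) :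
  deriv_mx v (fun y => (F y)^T) x = (deriv_mx v F x)^T.
Proof.
rewrite linear_sum; apply: eq_bigr => c _; rewrite linearZ /=; congr (_ *: _).
apply/matrixP => a b; rewrite !mxE; congr (partial _ _ _).
by apply: funext => y; rewrite mxE.
Qed.

End AtPoint.
End MatrixDerivative.

(** * Linear algebra of a dual pair *)

Section DualPairAlgebra.
Context {R : realType} {d : nat}.
Implicit Types (v w e : 'rV[R]_d) (W L : 'M[R]_d).

(** A nonzero [v] would annihilate the top form and so make it zero. *)
Lemma regular_kernel_eq0 n (w v : 'rV[R]_n.*2.+1) (W : 'M[R]_n.*2.+1) :
  W^T = - W ->
  (exists vs : 'I_(1 + n.*2) -> 'rV[R]_n.*2.+1,
     wedge (multiform1 w) (wedge_power W n) vs != 0) ->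
  v *m W = 0 -> v *m w^T = 0 -> v = 0.
Proof.
move=> Wskew [vs F0] vW vw; apply/eqP; apply: contraNT F0 => v0; apply/eqP.
apply: (@top_form_eq0 R n.*2.+1 (wedge (multiform1 w) (wedge_power W n)) v v0).
- apply: (@wedge_multilinear R n.*2.+1 1 n.*2).
    exact: multiform1_multilinear.
  exact: wedge_power_multilinear.
- exact: (@wedge_alternating R n.*2.+1 1 n.*2).
- apply: (@wedge_annihilated R n.*2.+1 v 1 n.*2); last first.
    exact: wedge_power_annihilated.
  by move=> us i; rewrite /multiform1 (ord1 i) /pairing => ->; rewrite vw mxE.
Qed.

(** The rows of [1 - W *m L - w^T *m e] are killed by [W] because
    [W *m L *m W = W], and by [w] because [e] is normalized, so the kernel
    hypothesis makes them zero. *)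
Lemma dual_pair_splitting w e W L :
  L^T = - L -> W *m L *m W = W -> w *m L = 0 -> e *m W = 0 ->
  e *m w^T = 1%:M ->
  (forall v, v *m W = 0 -> v *m w^T = 0 -> v = 0) ->
  W *m L + w^T *m e = 1%:M.
Proof.
move=> Lskew WLW wL eW ew ker.
have Lw : L *m w^T = 0.
  by rewrite -[L]trmxK -trmx_mul Lskew mulmxN wL oppr0 trmx0.
apply/eqP; rewrite eq_sym -subr_eq0; apply/eqP; apply/row_matrixP => i.
rewrite row0; apply: ker.
- rewrite -row_mul mulmxBl mulmxDl mul1mx WLW -mulmxA eW mulmx0 addr0 subrr.
  exact: row0.
- rewrite -row_mul mulmxBl mulmxDl mul1mx -!mulmxA Lw ew mulmx0 add0r mulmx1.
  by rewrite subrr row0.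
Qed.

Lemma dual_pair_splitting_tr w e W L :
  W^T = - W -> L^T = - L -> W *m L + w^T *m e = 1%:M ->
  L *m W + e^T *m w = 1%:M.
Proof.
move=> Wskew Lskew /(congr1 trmx); rewrite linearD /= !trmx_mul Wskew Lskew.
by rewrite mulNmx mulmxN opprK trmxK trmx1.
Qed.

(** Here [J] is the matrix of partial derivatives of [e], and [DW], [DL], [Dw]
    are the derivatives along [e], so that the Lie derivatives of [W], [L], [w]
    are [DW + J *m W + W *m J^T], [DL - J^T *m L - L *m J], [Dw + w *m J^T].
    Writing [K] for the Lie derivative of [L], the derivatives of
    [W *m L + w^T *m e = 1] and of [w *m L = 0] give [W *m K] and [w *m K], and
    the transposed splitting [L *m W + e^T *m w = 1] recovers [K] from them. *)
Lemma lie_bivector_algebra w e W L J DW DL Dw :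
  W^T = - W -> L^T = - L -> w *m L = 0 -> W *m L + w^T *m e = 1%:M ->
  DW + J *m W + W *m J^T = 0 ->
  DW *m L + W *m DL + (Dw^T *m e + w^T *m (e *m J)) = 0 ->
  Dw *m L + w *m DL = 0 ->
  DL - J^T *m L - L *m J
  = - (L *m (Dw + w *m J^T)^T *m e) - e^T *m ((Dw + w *m J^T) *m L).
Proof.
move=> Wskew Lskew wL split symW Dsplit DwL.
have split' := dual_pair_splitting_tr Wskew Lskew split.
set K := LHS.
have WK : W *m K = - ((Dw + w *m J^T)^T *m e).
  have Jsplit : J *m W *m L + J *m w^T *m e = J.
    by rewrite -!mulmxA -mulmxDr split mulmx1.
  have splitJ : W *m L *m J + w^T *m e *m J = J.
    by rewrite -mulmxDl split mul1mx.
  have symWL : DW *m L + J *m W *m L + W *m J^T *m L = 0.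
    by rewrite -!mulmxDl symW mul0mx.
  (* a linear identity between matrix products, checked entry by entry *)
  rewrite [(Dw + _)^T]linearD /= trmx_mul trmxK mulmxDl !mulmxBr.
  move: Dsplit Jsplit splitJ symWL; rewrite !mulmxA.
  move=> /matrixP h1 /matrixP h2 /matrixP h3 /matrixP h4.
  apply/matrixP => a b; move: (h1 a b) (h2 a b) (h3 a b) (h4 a b).
  move: (W *m DL) (W *m J^T *m L) (W *m L *m J) (Dw^T *m e) (J *m w^T *m e)
    (J *m W *m L) (DW *m L) (w^T *m e *m J) => m1 m2 m3 m4 m5 m6 m7 m8.
  by rewrite !mxE; lra.
have wK : w *m K = - ((Dw + w *m J^T) *m L).
  rewrite !mulmxBr mulmxDl !mulmxA wL mul0mx subr0 opprD; congr (_ - _).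
  by apply/eqP; rewrite -addr_eq0 addrC; apply/eqP.
rewrite -[K]mul1mx -split' mulmxDl -!mulmxA WK wK !mulmxN.
by rewrite !mulmxA.
Qed.

End DualPairAlgebra.

(** * Lie derivatives along the Reeb field *)

Section ReebSymmetries.
Context {R : realType} {n : nat} {M : smooth_manifold R n.*2.+1}.
Context (om : one_form M) (Om : two_form M).
Context (E : vector_field M) (L : bivector_field M).
Hypothesis reg : regular_almost_cosymplectic_contact om Om.
Hypothesis dual : dual_pair om Om E L.

Section InChart.
Context (i : chart_index M).
Local Notation U := (chart_im i).

Let Uo : open U.
Proof. exact: chart_im_open. Qed.

Let Es : smooth_mx U (E i).
Proof. by move=> a b; rewrite (ord1 a); exact: vf_smooth. Qed.

Let form1_smooth_mx (al : one_form M) : smooth_mx U (al i).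
Proof. by move=> a b; rewrite (ord1 a); exact: form1_smooth. Qed.

Let Ws : smooth_mx U (Om i).
Proof. by move=> a b; exact: form2_smooth. Qed.

Let Ls : smooth_mx U (L i).
Proof. by move=> a b; exact: bv_smooth. Qed.

Lemma reeb_pairing x : U x -> E i x *m (om i x)^T = 1%:M.
Proof.
case/dual => _ _ Ew _ _; apply/matrixP => a b; rewrite (ord1 a) (ord1 b).
by rewrite [RHS]mxE eqxx; exact: Ew.
Qed.

Lemma reeb_flat x : U x -> E i x *m Om i x = 0.
Proof. by case/dual. Qed.

Lemma form_sharp x : U x -> om i x *m L i x = 0.
Proof. by case/dual. Qed.

Lemma chart_splitting x : U x ->
  Om i x *m L i x + (om i x)^T *m E i x = 1%:M.
Proof.
move=> Ux; have [_ WLW _ _ _] := dual Ux.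
have Wskew := form2_skew Om Ux; have Lskew := bv_skew L Ux.
apply: dual_pair_splitting => //.
- apply/row_matrixP => a; rewrite -mulmxA row_mul mulmxA.
  by apply: WLW; exists (delta_mx 0 a) => //; rewrite rowE.
- exact: form_sharp.
- exact: reeb_flat.
- exact: reeb_pairing.
- by move=> v; apply: regular_kernel_eq0 => //; exact: (proj2 reg).
Qed.

Definition gradient_mx (F : 'rV[R]_n.*2.+1 -> 'rV[R]_n.*2.+1) x :
  'M[R]_n.*2.+1 := \matrix_(a, b) partial a (fun y => F y 0 b) x.

Lemma deriv_mx_gradient v F x : deriv_mx v F x = v *m gradient_mx F x.
Proof.
apply/rowP => b; rewrite deriv_mxE mxE.
by apply: eq_bigr => c _; rewrite mxE.
Qed.

Lemma lie_form1E al x : lie_form1 E al i x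
  = deriv_mx (E i x) (al i) x + al i x *m (gradient_mx (E i) x)^T.
Proof.
apply/rowP => a; rewrite !mxE deriv_mxE -big_split /=.
by apply: eq_bigr => b _; rewrite !mxE.
Qed.

Lemma lie_bracketE X x : lie_bracket X E i x
  = X i x *m gradient_mx (E i) x - deriv_mx (E i x) (X i) x.
Proof.
apply/rowP => a; rewrite !mxE deriv_mxE -sumrB.
by apply: eq_bigr => b _; rewrite !mxE.
Qed.

Section AtPoint.
Context (x : 'rV[R]_n.*2.+1) (Ux : U x).
Local Notation J := (gradient_mx (E i) x).
Local Notation D := (deriv_mx (E i x)).

(** Contracting [d Omega = 0] with [E] expresses the derivative of [W] along
    [E] by contractions of [E] with other partial derivatives of [W]; deriving
    [E *m W = 0] identifies these with entries of [J *m W]. *)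
Lemma reeb_lie_form2_eq0 : D (Om i) x + J *m Om i x + Om i x *m J^T = 0.
Proof.
have dE c a : (J *m Om i x) c a
    + \sum_b E i x 0 b * partial c (fun y => Om i y b a) x = 0.
  have := partial_mxM Ux c Es Ws.
  rewrite (partial_mx_local Uo Ux c reeb_flat) partial_mx_cst.
  move/rowP/(_ a); rewrite !mxE => /esym; congr (_ + _ = _).
  - by apply: eq_bigr => b _; rewrite !mxE.
  - by apply: eq_bigr => b _; rewrite !mxE.
apply/matrixP => a b; rewrite [LHS]mxE [X in X + _]mxE [RHS]mxE deriv_mxE.
have -> : (Om i x *m J^T) a b = - (J *m Om i x) b a.
  rewrite -[J in RHS]trmxK -[Om i x in RHS]trmxK -trmx_mul.
  by rewrite (form2_skew Om Ux) mulNmx !mxE opprK.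
have -> : (J *m Om i x) b a
    = - \sum_c E i x 0 c * partial b (fun y => Om i y c a) x.
  by apply/eqP; rewrite -addr_eq0 dE.
have -> : (J *m Om i x) a b
    = - \sum_c E i x 0 c * partial a (fun y => Om i y c b) x.
  by apply/eqP; rewrite -addr_eq0 dE.
rewrite opprK -sumrN -!big_split big1 //= => c _.
have skew : partial a (fun y => Om i y b c) x
    = - partial a (fun y => Om i y c b) x.
  rewrite -[RHS]deriveN; last exact: smooth_on_derivable (Ws c b) Ux.
  apply: partial_local Uo Ux _ => y Uy.
  by have /matrixP/(_ c b) := form2_skew Om Uy; rewrite !mxE.
have := (proj1 reg) i x Ux c a b.
rewrite /ext_deriv2 skew => dW.
by rewrite -mulrN -!mulrDr dW mulr0.
Qed.

Let lam := lie_form1 E om i x.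

Lemma reeb_lie_bivector :
  D (L i) x - J^T *m L i x - L i x *m J
  = - (L i x *m lam^T *m E i x) - (E i x)^T *m (lam *m L i x).
Proof.
rewrite /lam lie_form1E.
apply: (@lie_bivector_algebra _ _ _ _ (Om i x) _ _ (D (Om i) x)).
- exact: form2_skew.
- exact: bv_skew.
- exact: form_sharp.
- exact: chart_splitting.
- exact: reeb_lie_form2_eq0.
- have omE := smooth_mx_mul Uo (smooth_mx_tr (form1_smooth_mx om)) Es.
  have WL := smooth_mx_mul Uo Ws Ls.
  have := deriv_mxD Ux (E i x) WL omE.
  rewrite (deriv_mx_local Uo Ux _ chart_splitting) deriv_mx_cst.
  rewrite (deriv_mxM Ux _ Ws Ls).
  rewrite (deriv_mxM Ux _ (smooth_mx_tr (form1_smooth_mx om)) Es).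
  by rewrite deriv_mx_tr (deriv_mx_gradient _ (E i)) => <-.
- have := deriv_mxM Ux (E i x) (form1_smooth_mx om) Ls.
  by rewrite (deriv_mx_local Uo Ux _ form_sharp) deriv_mx_cst => <-.
Qed.

(** The terms with [J] cancel because [J] is the derivative of [E] itself, and
    [reeb_lie_bivector] replaces the derivative of Lambda. *)
Lemma reeb_bracket X al (h : smooth_function M) :
  is_sharp_Reeb_combination E L X al h ->
  lie_bracket X E i x
  = - (sharp (L i x) (lie_form1 E al i x - pairing (al i x) (E i x) *: lam)
       + (fun_deriv E h i x + bv_eval (L i x) lam (al i x)) *: E i x).
Proof.
move=> XE; rewrite lie_bracketE.
(* as a 1 x 1 matrix, [h] falls under the matrix Leibniz rule *)
pose hm y : 'M[R]_1 := (local_fun h i y)%:M.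
have hs : smooth_mx U hm.
  move=> a b; rewrite (ord1 a) (ord1 b) /hm.
  by under eq_fun do rewrite mxE eqxx mulr1n; exact: fun_smooth.
have XE' y : U y -> X i y = al i y *m L i y + hm y *m E i y.
  by move=> Uy; rewrite mul_scalar_mx; exact: XE.
have Dh : D hm x = (fun_deriv E h i x)%:M.
  apply/matrixP => a b; rewrite (ord1 a) (ord1 b) deriv_mxE mxE eqxx mulr1n.
  apply: eq_bigr => c _; congr (_ * partial _ _ _).
  by apply: funext => y; rewrite mxE eqxx mulr1n.
have als := form1_smooth_mx al.
rewrite (deriv_mx_local Uo Ux _ XE') (XE' _ Ux).
rewrite (deriv_mxD Ux _ (smooth_mx_mul Uo als Ls) (smooth_mx_mul Uo hs Es)).
rewrite (deriv_mxM Ux _ als Ls) (deriv_mxM Ux _ hs Es) Dh.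
rewrite (deriv_mx_gradient _ (E i)) lie_form1E.
have DL : D (L i) x = - (L i x *m lam^T *m E i x)
    - (E i x)^T *m (lam *m L i x) + L i x *m J + J^T *m L i x.
  by rewrite -reeb_lie_bivector !addrNK.
have alE : al i x *m (E i x)^T = (pairing (al i x) (E i x))%:M.
  rewrite [LHS]mx11_scalar; congr _%:M.
  by rewrite /pairing !mxE; apply: eq_bigr => c _; rewrite !mxE mulrC.
have alLlam : al i x *m L i x *m lam^T = - (bv_eval (L i x) lam (al i x))%:M.
  rewrite [LHS]mx11_scalar -raddfN; congr _%:M; rewrite /bv_eval.
  transitivity (((al i x *m L i x *m lam^T)^T) 0 0); first by rewrite [RHS]mxE.
  by rewrite !trmx_mul trmxK (bv_skew L Ux) mulNmx mulmxN mulmxA [LHS]mxE.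
rewrite DL /sharp !mulmxDr !mulmxN !mulmxDl !mulmxA alLlam alE.
rewrite !mulNmx !mul_scalar_mx -!scalemxAl scalerDl.
move: (al i x *m J^T *m L i x) (al i x *m L i x *m J) (D (al i) x *m L i x).
move: (lam *m L i x) (E i x *m J) => m4 m5 m1 m2 m3.
by apply/rowP => a; rewrite !mxE; ring.
Qed.

(** Pairing with omega kills the sharp part and isolates the coefficient of
    [E]. *)
Lemma reeb_sum_eq0 r (s : R) :
  sharp (L i x) r + s *: E i x = 0 -> sharp (L i x) r = 0 /\ s = 0.
Proof.
move=> rs0.
have Lom : L i x *m (om i x)^T = 0.
  by rewrite -[L i x]trmxK -trmx_mul (bv_skew L Ux) mulmxN form_sharp //
    oppr0 trmx0.
have s0 : s = 0.
  have := congr1 (fun v => (v *m (om i x)^T) 0 0) rs0.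
  rewrite mulmxDl -mulmxA Lom mulmx0 add0r -scalemxAl reeb_pairing // mul0mx.
  by rewrite !mxE eqxx mulr1.
by move: rs0; rewrite s0 scale0r addr0.
Qed.

Lemma reeb_decomposition v :
  v = sharp (L i x) (flat (Om i x) v) + pairing (om i x) v *: E i x.
Proof.
rewrite -[LHS]mulmx1 -(chart_splitting Ux) mulmxDr !mulmxA; congr (_ + _).
by rewrite -mul_scalar_mx; congr (_ *m _); exact: mx11_scalar.
Qed.

End AtPoint.
End InChart.

(** * The components of a vector field *)

Section Components.
Variable X : vector_field M.

Let flat_rep (i : chart_index M) x := flat (Om i x) (X i x).

Let flat_rep_smooth i a : smooth_on (chart_im i) (fun x => flat_rep i x 0 a).
Proof.
apply: smooth_mx_mul => [|b c|b c]; first exact: chart_im_open.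
  by rewrite (ord1 b); exact: vf_smooth.
exact: form2_smooth.
Qed.

Let flat_rep_transform i j x : overlap i j x ->
  flat_rep i x = flat_rep j (transition i j x) *m ('J (transition i j) x)^T.
Proof.
move=> ijx; rewrite /flat_rep /flat (vf_transform X ijx).
by rewrite (form2_transform Om ijx) !mulmxA.
Qed.

Definition flat_form : one_form M := OneForm flat_rep_smooth flat_rep_transform.

Let pairing_rep (i : chart_index M) x := pairing (om i x) (X i x).

Let pairing_rep_invariant i j x : overlap i j x ->
  pairing_rep j (transition i j x) = pairing_rep i x.
Proof.
move=> ijx; rewrite /pairing_rep /pairing (vf_transform X ijx).
by rewrite (form1_transform om ijx) trmx_mul trmxK mulmxA.
Qed.

(* The value at [p] is read off in a chosen chart around [p]; by the
   transformation laws the choice is immaterial. *)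
Let chart_at (p : M) : chart_index M := projT1 (cid (chart_cover p)).

Let chart_atP p : chart_dom (chart_at p) p.
Proof. by rewrite /chart_at; case: cid. Qed.

Let pairing_val (p : M) := pairing_rep (chart_at p) (chart (chart_at p) p).

Let local_pairing i x : chart_im i x ->
  pairing_rep i x = local_fun pairing_val i x.
Proof.
case=> p ip <-; rewrite /local_fun /= (chartK ip).
rewrite -(@pairing_rep_invariant i (chart_at p)).
  by rewrite /transition /= (chartK ip).
by exists p => //; split => //; exact: chart_atP.
Qed.

Let pairing_val_smooth i : smooth_on (chart_im i) (local_fun pairing_val i).
Proof.
have omX : smooth_mx (chart_im i) (fun x => X i x *m (om i x)^T).
  apply: smooth_mx_mul => [|b c|]; first exact: chart_im_open.
    by rewrite (ord1 b); exact: vf_smooth.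
  by apply: smooth_mx_tr => b c; rewrite (ord1 b); exact: form1_smooth.
exact: (smooth_on_local (@chart_im_open _ _ M i) (@local_pairing i) (omX 0 0)).
Qed.

Definition pairing_fun : smooth_function M := SmoothFunction pairing_val_smooth.

Lemma local_pairing_fun i x : chart_im i x ->
  local_fun pairing_fun i x = pairing (om i x) (X i x).
Proof. by move=> Ux; rewrite -local_pairing. Qed.

End Components.

Lemma sharp_Reeb_decomposition X :
  is_sharp_Reeb_combination E L X (flat_form X) (pairing_fun X).
Proof.
by move=> i x Ux; rewrite local_pairing_fun //; exact: reeb_decomposition.
Qed.

Lemma symmetry_combinationP X al (h : smooth_function M) :
  is_sharp_Reeb_combination E L X al h ->
  infinitesimal_symmetry X E <->
  (forall i x, chart_im i x ->
     sharp (L i x) (lie_form1 E al i x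
                    - pairing (al i x) (E i x) *: lie_form1 E om i x) = 0) /\
  (forall i x, chart_im i x ->
     fun_deriv E h i x + bv_eval (L i x) (lie_form1 E om i x) (al i x) = 0).
Proof.
move=> XE; split => [sym|[alE hE] i x Ux].
  have comps i x (Ux : chart_im i x) : _ /\ _ := reeb_sum_eq0 Ux
    (oppr_inj (etrans (etrans (esym (reeb_bracket Ux XE)) (sym i x Ux))
                      (esym (oppr0 _)))).
  by split => i x Ux; have [] := comps i x Ux.
by rewrite (reeb_bracket Ux XE) alE // hE // scale0r addr0 oppr0.
Qed.

End ReebSymmetries.

Theorem theorem2p6 (R : realType) (n : nat) (M : smooth_manifold R n.*2.+1)
    (om : one_form M) (Om : two_form M)
    (E : vector_field M) (L : bivector_field M)
    (hreg : regular_almost_cosymplectic_contact om Om)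
    (hdual : dual_pair om Om E L)
    (X : vector_field M) :
  infinitesimal_symmetry X E <->
  exists (al : one_form M) (h : smooth_function M),
    [/\ is_sharp_Reeb_combination E L X al h,
        forall (i : chart_index M) x, chart_im i x ->
          sharp (L i x)
            (lie_form1 E al i x
             - pairing (al i x) (E i x) *: lie_form1 E om i x) = 0 &
        forall (i : chart_index M) x, chart_im i x ->
          fun_deriv E h i x + bv_eval (L i x) (lie_form1 E om i x) (al i x)
          = 0].
Proof.
split=> [sym | [al [h [XE alE hE]]]].
  have XE := sharp_Reeb_decomposition hreg hdual X.
  have [alE hE] := (symmetry_combinationP hreg hdual XE).1 sym.
  by exists (flat_form Om X), (pairing_fun om X); split.
exact/(symmetry_combinationP hreg hdual XE).
Qed.
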